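(* For every $n\in\mathbb{N}$, let $M_n$ be the average resistance of all $n$-circuits. Then $$M_n\ge 1 .$$
   Context: $\mathbb{N}=\{1,2,3,\dots\}$. Circuits are defined recursively and represented by ordered pairs of multisets. The unit circuit $(\{\},\{\})$ is a single unit resistor; it is considered to be both a series and a parallel circuit. A (non-unit) series circuit is a pair $(\{\alpha_1,\dots,\alpha_m\},\{\})$ where $\{\alpha_1,\dots,\alpha_m\}$ is a finite multiset of $m\ge 2$ parallel circuits (the unit circuit being allowed). A (non-unit) parallel circuit is a pair $(\{\},\{\beta_1,\dots,\beta_m\})$ where $\{\beta_1,\dots,\beta_m\}$ is a finite multiset of $m\ge 2$ series circuits (the unit circuit being allowed). Two circuits are the same iff these representations are equal. An $n$-circuit is a circuit containing exactly $n$ unit resistors (the unit circuit contains one; otherwise add the numbers in the sub-circuits). The resistance $r$ is defined by $r=1$ for the unit circuit, $r=\sum_i r(\alpha_i)$ for a series circuit with sub-circuits $\alpha_i$, and $r=\left(\sum_i r(\beta_i)^{-1}\right)^{-1}$ for a parallel circuit with sub-circuits $\beta_i$. $\Gamma_n$ is the (finite) set of all $n$-circuits, $Q_n=|\Gamma_n|$, $R_n=\sum_{\gamma\in\Gamma_n} r(\gamma)$, and $M_n=R_n/Q_n$. *)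

(* Defs.v *)
From HB Require Import structures.
From mathcomp Require Import all_boot all_order all_algebra.
From mathcomp Require Import finmap multiset.

Set Implicit Arguments.
Unset Strict Implicit.
Unset Printing Implicit Defensive.

Import GRing.Theory.
Local Open Scope mset_scope.
Local Open Scope ring_scope.

(* A multiset is represented by the sorted list of its elements, so that
   Leibniz equality of hereditarily sorted trees is equality of nested
   multisets; see mpairK, mpair_inj and mpair_ind below. *)

Unset Elimination Schemes.
Inductive tree := Node of seq tree & seq tree.
Set Elimination Schemes.

Fixpoint tree_encode (t : tree) : GenTree.tree void :=
  let: Node A B := t in
  GenTree.Node 0 [:: GenTree.Node 0 (map tree_encode A);
                     GenTree.Node 0 (map tree_encode B)].

Fixpoint tree_decode (g : GenTree.tree void) : option tree :=
  if g is GenTree.Node _ [:: GenTree.Node _ A; GenTree.Node _ B] then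
    Some (Node (pmap tree_decode A) (pmap tree_decode B))
  else None.

Fixpoint tree_ind_foldr (K : tree -> Prop)
  (IH : forall A B, foldr (fun x => and (K x)) True A ->
     foldr (fun x => and (K x)) True B -> K (Node A B)) (t : tree) : K t :=
  let: Node A B := t in
  let fix all_K (s : seq tree) : foldr (fun x => and (K x)) True s :=
    if s is x :: s' then conj (tree_ind_foldr IH x) (all_K s') else I in
  IH A B (all_K A) (all_K B).

Lemma tree_codeK : pcancel tree_encode tree_decode.
Proof.
have aux s : foldr (fun x => and (tree_decode (tree_encode x) = Some x)) True s ->
  pmap tree_decode (map tree_encode s) = s.
  by elim: s => //= x s IH [-> /IH /= ->].
by elim/tree_ind_foldr => A B /aux hA /aux hB /=; rewrite hA hB.
Qed.

HB.instance Definition _ := Countable.copy tree (pcan_type tree_codeK).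

Lemma tree_ind (K : tree -> Prop) :
  (forall A B, {in A, forall x, K x} -> {in B, forall x, K x} -> K (Node A B)) ->
  forall t, K t.
Proof.
move=> IH; elim/tree_ind_foldr => A B hA hB.
have aux s : foldr (fun x => and (K x)) True s -> {in s, forall x, K x}.
  elim: s => [|y s IHs] //= [Ky /IHs Ks] x; rewrite inE.
  by case/orP => [/eqP -> //|/Ks].
by apply: IH; apply: aux.
Qed.

(* The order is arbitrary: it only serves to choose one list per multiset. *)
Definition tree_le : rel tree := relpre (@choice.pickle tree) leq.

Lemma tree_le_total : total tree_le.
Proof. by move=> x y; apply: leq_total. Qed.
Lemma tree_le_trans : transitive tree_le.
Proof. by move=> y x z; apply: leq_trans. Qed.
Lemma tree_le_anti : antisymmetric tree_le.
Proof.
by move=> x y /anti_leq /(pcan_inj (@choice.pickleK tree)).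
Qed.

Fixpoint tree_sorted (t : tree) : bool :=
  let: Node A B := t in
  [&& sorted tree_le A, sorted tree_le B, all tree_sorted A & all tree_sorted B].

(* Hereditary pairs of finite multisets. *)
Definition mtree := {t : tree | tree_sorted t}.
HB.instance Definition _ := Countable.on mtree.

Definition mlist (s : seq tree) : {mset mtree} := seq_mset (pmap insub s).
Definition mfst (t : mtree) : {mset mtree} := let: Node A _ := val t in mlist A.
Definition msnd (t : mtree) : {mset mtree} := let: Node _ B := val t in mlist B.

Definition mpair_tree (A B : {mset mtree}) : tree :=
  Node (sort tree_le (map val (enum_mset A))) (sort tree_le (map val (enum_mset B))).

Lemma mpair_sorted A B : tree_sorted (mpair_tree A B).
Proof.
rewrite /= !(sort_sorted tree_le_total) !all_sort /=.
by apply/andP; split; apply/allP => _ /mapP[x _ ->]; apply: (valP x).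
Qed.

Definition mpair (A B : {mset mtree}) : mtree :=
  exist (fun t => tree_sorted t) (mpair_tree A B) (mpair_sorted A B).

Lemma mlist_sort (A : {mset mtree}) :
  mlist (sort tree_le (map val (enum_mset A))) = A.
Proof.
rewrite -[RHS]seq_mset_id; apply/eq_seq_msetP.
apply: (@perm_trans _ (pmap insub (map val (enum_mset A)))).
  by apply: perm_pmap; rewrite perm_sort.
by rewrite map_pK //; apply: valK.
Qed.

Lemma sort_mlist (s : seq tree) : sorted tree_le s -> all tree_sorted s ->
  sort tree_le (map val (enum_mset (mlist s))) = s.
Proof.
move=> ss hs; apply: (sorted_eq tree_le_trans tree_le_anti) => //.
  exact: sort_sorted tree_le_total _.
rewrite perm_sort; apply: (@perm_trans _ (map val (pmap insub s : seq mtree))).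
  by apply: perm_map; apply: perm_eq_seq_mset.
rewrite (pmap_filter (insubK _)).
by have /all_filterP -> : all (isSome \o (insub : tree -> option mtree)) s
  by apply: sub_all hs => x hx /=; rewrite insubT.
Qed.

Lemma mfst_mpair A B : mfst (mpair A B) = A.
Proof. exact: mlist_sort. Qed.
Lemma msnd_mpair A B : msnd (mpair A B) = B.
Proof. exact: mlist_sort. Qed.

Lemma mpairK t : mpair (mfst t) (msnd t) = t.
Proof.
apply: val_inj; case: t => [[A B] /= h]; rewrite /mfst /msnd /mpair_tree /=.
by case/and4P: h => *; rewrite !sort_mlist.
Qed.

Lemma mpair_inj A B A' B' : mpair A B = mpair A' B' -> A = A' /\ B = B'.
Proof.
move=> e; split; first by rewrite -(mfst_mpair A B) e mfst_mpair.
by rewrite -(msnd_mpair A B) e msnd_mpair.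
Qed.

Lemma mpair_ind (K : mtree -> Prop) :
  (forall A B : {mset mtree}, {in A, forall x, K x} -> {in B, forall x, K x} ->
     K (mpair A B)) ->
  forall t, K t.
Proof.
move=> IH [t ht]; elim: t ht => A B IA IB ht.
rewrite -[exist _ _ _]mpairK.
have aux s : {in s, forall (x : tree) (hx : tree_sorted x),
    K (exist (fun t => tree_sorted t) x hx)} -> {in mlist s, forall x, K x}.
  move=> hs [x hx]; rewrite (perm_mem (perm_eq_seq_mset _)) mem_pmap_sub.
  by move=> /hs; apply.
by apply: IH; apply: aux.
Qed.

Fixpoint tree_series (t : tree) : bool :=
  let: Node A B := t in
  nilp B && (nilp A || (1 < size A)%N && all tree_parallel A)
with tree_parallel (t : tree) : bool :=
  let: Node A B := t in
  nilp A && (nilp B || (1 < size B)%N && all tree_series B).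

Fixpoint tree_size (t : tree) : nat :=
  let: Node A B := t in
  if nilp A && nilp B then 1%N
  else (sumn (map tree_size A) + sumn (map tree_size B))%N.

(* On trees that are not circuits (both components nonempty) the value is
   irrelevant. *)
Fixpoint tree_resistance (t : tree) : rat :=
  let: Node A B := t in
  if nilp B then
    if nilp A then 1 else foldr (fun a x => tree_resistance a + x) 0 A
  else (foldr (fun b x => (tree_resistance b)^-1 + x) 0 B)^-1.

Definition is_series (t : mtree) : bool := tree_series (val t).
Definition is_parallel (t : mtree) : bool := tree_parallel (val t).

Definition circuit := {t : mtree | is_series t || is_parallel t}.
HB.instance Definition _ := Countable.on circuit.

Definition circuit_size (c : circuit) : nat := tree_size (val (val c)).
Definition resistance (c : circuit) : rat := tree_resistance (val (val c)).

Lemma nilp_sort_mset (A : {mset mtree}) :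
  nilp (sort tree_le (map val (enum_mset A))) = (A == mset0).
Proof. by rewrite /nilp size_sort size_map size_mset_eq0. Qed.

(* The recursive definitions, read on pairs of multisets. *)
Lemma is_seriesE (A B : {mset mtree}) :
  is_series (mpair A B) =
  (B == mset0) && ((A == mset0) || (1 < size A)%N && all is_parallel A).
Proof.
by rewrite /is_series /= !nilp_sort_mset size_sort size_map all_sort all_map.
Qed.

Lemma is_parallelE (A B : {mset mtree}) :
  is_parallel (mpair A B) =
  (A == mset0) && ((B == mset0) || (1 < size B)%N && all is_series B).
Proof.
by rewrite /is_parallel /= !nilp_sort_mset size_sort size_map all_sort all_map.
Qed.

Lemma tree_sizeE (A B : {mset mtree}) :
  tree_size (val (mpair A B)) =
  if (A == mset0) && (B == mset0) then 1%N
  else (\sum_(a <- A) tree_size (val a) + \sum_(b <- B) tree_size (val b))%N.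
Proof.
have aux (C : {mset mtree}) :
    sumn (map tree_size (sort tree_le (map val (enum_mset C)))) =
    (\sum_(c <- C) tree_size (val c))%N.
  rewrite sumnE big_map -(big_map val xpredT tree_size).
  by apply: perm_big; rewrite perm_sort.
by rewrite /= !nilp_sort_mset !aux.
Qed.

Lemma tree_resistanceE (A B : {mset mtree}) :
  tree_resistance (val (mpair A B)) =
  if B == mset0 then
    if A == mset0 then 1 else \sum_(a <- A) tree_resistance (val a)
  else (\sum_(b <- B) (tree_resistance (val b))^-1)^-1.
Proof.
have aux (f : tree -> rat) (C : {mset mtree}) :
    foldr (fun c x => f c + x) 0 (sort tree_le (map val (enum_mset C))) =
    \sum_(c <- C) f (val c).
  rewrite -(big_map val xpredT f) -(perm_big _ (permEl (perm_sort tree_le _))) /=.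
  by elim: (sort _ _) => [|x s IH]; rewrite ?big_nil // big_cons /= IH.
by rewrite /= !nilp_sort_mset (aux tree_resistance) (aux (fun b => (tree_resistance b)^-1)).
Qed.

Definition ncircuit (n : nat) := {c : circuit | circuit_size c == n}.
HB.instance Definition _ (n : nat) := Countable.on (ncircuit n).

Section Finiteness.
Variable n : nat.

Fixpoint seqs (L : seq tree) (k : nat) : seq (seq tree) :=
  if k is k'.+1 then [::] :: [seq x :: s | x <- L, s <- seqs L k'] else [:: [::]].

Fixpoint trees (k : nat) : seq tree :=
  if k is k'.+1 then
    [seq Node A B | A <- seqs (trees k') n, B <- seqs (trees k') n]
  else [::].

Lemma mem_seqs L k s : (size s <= k)%N -> all (mem L) s -> s \in seqs L k.
Proof.
elim: k s => [|k IH] [|x s] //=; rewrite ltnS inE => hs /andP[hx hL].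
by rewrite orFb; apply/allpairsPdep; exists x, s; split => //; apply: IH.
Qed.

Lemma tree_size_gt0 t : tree_series t || tree_parallel t -> (0 < tree_size t)%N.
Proof.
have aux (p : pred tree) (s : seq tree) :
    {in s, forall x, tree_series x || tree_parallel x -> (0 < tree_size x)%N} ->
    (forall x, p x -> tree_series x || tree_parallel x) ->
    (1 < size s)%N -> all p s -> (0 < sumn (map tree_size s))%N.
  case: s => [|x s] //= hs hp _ /andP[/hp px _].
  by rewrite addn_gt0 hs ?mem_head.
elim: t => A B IA IB /=; case: ifP => // h /orP[]; case/andP => [/nilP e];
  move: IA IB h; rewrite e /= ?andbT ?addn0 ?add0n => IA IB h;
  rewrite h /= => /andP[h1 h2].
- by apply: aux h1 h2 => // x ->; rewrite orbT.
- by apply: aux h1 h2 => // x ->.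
Qed.

Lemma mem_trees k t : tree_series t || tree_parallel t ->
  (tree_size t <= k)%N -> (tree_size t <= n)%N -> t \in trees k.
Proof.
have aux (p : pred tree) (s : seq tree) k' : (forall x, p x -> tree_series x || tree_parallel x) ->
    (forall x, tree_series x || tree_parallel x -> (tree_size x <= k')%N ->
       (tree_size x <= n)%N -> x \in trees k') ->
    (1 < size s)%N -> all p s -> (sumn (map tree_size s) <= k'.+1)%N ->
    (sumn (map tree_size s) <= n)%N -> s \in seqs (trees k') n.
  move=> hp IH s1 ps hk hn.
  have pos (u : seq tree) : all p u -> (size u <= sumn (map tree_size u))%N.
    elim: u => //= x u IHu /andP[/hp /tree_size_gt0 px /IHu hu].
    by rewrite -add1n leq_add.
  apply: mem_seqs; first exact: leq_trans (pos _ ps) hn.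
  apply/allP => x xs; have px : tree_series x || tree_parallel x.
    by apply: hp; apply: (allP ps).
  have e : sumn (map tree_size s) = (tree_size x + sumn (map tree_size (rem x s)))%N.
    by rewrite !sumnE !big_map (perm_big _ (perm_to_rem xs)) big_cons.
  have r1 : (0 < sumn (map tree_size (rem x s)))%N.
    apply: leq_trans (pos _ _); first by rewrite size_rem // -subn1 subn_gt0.
    by apply/allP => y /mem_rem; apply: (allP ps).
  apply: IH => //.
    by rewrite -ltnS; apply: leq_trans hk; rewrite e -addn1 leq_add2l.
  by apply: leq_trans hn; rewrite e leq_addr.
elim: k t => [|k IH] t ht hk hn.
  by move: (tree_size_gt0 ht); rewrite ltnNge hk.
have nil0 L j : [::] \in seqs L j by apply: mem_seqs.
case: t ht hk hn => A B ht hk hn; apply/allpairsPdep; exists A, B.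
suff [hA hB] : A \in seqs (trees k) n /\ B \in seqs (trees k) n by split.
move: ht hk hn => /=; case: ifP => [/andP[/nilP -> /nilP ->] //|h].
case/orP; case/andP => [/nilP e]; move: h; rewrite e /= ?andbT ?addn0 ?add0n => h;
  rewrite h /= => /andP[h1 h2] hk hn; split => //.
- by apply: aux h1 h2 hk hn => // x ->; rewrite orbT.
- by apply: aux h1 h2 hk hn => // x ->.
Qed.

Definition ncircuit_enum : seq (ncircuit n) :=
  undup (pmap insub (pmap insub (pmap insub (trees n)))).

Lemma ncircuit_enumP : Finite.axiom ncircuit_enum.
Proof.
apply: Finite.uniq_enumP; first exact: undup_uniq.
move=> c; rewrite mem_undup !mem_pmap_sub /=.
have /eqP hc := valP c.
by apply: mem_trees; rewrite ?(valP (val c)) // -[X in (_ <= X)%N]hc.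
Qed.

End Finiteness.

HB.instance Definition _ (n : nat) := isFinite.Build (ncircuit n) (@ncircuit_enumP n).

Definition circuit_count (n : nat) : nat := #|{: ncircuit n}|.
Definition total_resistance (n : nat) : rat :=
  \sum_(c : ncircuit n) resistance (val c).
Definition mean_resistance (n : nat) : rat :=
  total_resistance n / (circuit_count n)%:R.

(* Main.v *)
Require Import Defs.
From mathcomp Require Import all_boot all_order all_algebra.

Import Order.TTheory GRing.Theory Num.Theory.
Local Open Scope ring_scope.

(* Exchanging series and parallel throughout a circuit is an involution of the
   n-circuits which inverts the resistance. Hence 2 R_n is the sum of
   r + r^-1 over all n-circuits, and each of these terms is at least 2. *)

Lemma nilp_sort (T : Type) (leT : rel T) (s : seq T) :
  nilp (sort leT s) = nilp s.
Proof. by rewrite /nilp size_sort. Qed.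

Lemma nilp_map (T U : Type) (f : T -> U) (s : seq T) : nilp (map f s) = nilp s.
Proof. by rewrite /nilp size_map. Qed.

Lemma sorted_nseq (T : Type) (leT : rel T) (n : nat) (x : T) :
  reflexive leT -> sorted leT (nseq n x).
Proof. by move=> leTT; case: n => //= n; elim: n => //= n ->; rewrite leTT. Qed.

(** Dualising the entries of a sorted list may disturb their order. Sorting again restores the list
    that represents the multiset. *)
Fixpoint tree_dual (t : tree) : tree :=
  let: Node A B := t in
  Node (sort tree_le (map tree_dual B)) (sort tree_le (map tree_dual A)).

Lemma tree_dual_sorted (t : tree) : tree_sorted (tree_dual t).
Proof.
elim: t => A B IA IB /=.
rewrite !(sort_sorted tree_le_total) !all_sort !all_map /=.
by apply/andP; split; apply/allP.
Qed.

(** By induction, dualising twice only permutes each list, and two sorted lists that are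
    permutations of each other are equal. *)
Lemma tree_dualK (t : tree) : tree_sorted t -> tree_dual (tree_dual t) = t.
Proof.
have aux (s : seq tree) :
    {in s, forall x, tree_sorted x -> tree_dual (tree_dual x) = x} ->
    sorted tree_le s -> all tree_sorted s ->
    sort tree_le (map tree_dual (sort tree_le (map tree_dual s))) = s.
  move=> IH ss /allP hs; apply: (sorted_eq tree_le_trans tree_le_anti) => //.
    exact: sort_sorted tree_le_total _.
  rewrite perm_sort.
  apply: (@perm_trans _ (map tree_dual (map tree_dual s))).
    by apply: perm_map; rewrite perm_sort.
  by rewrite -map_comp map_id_in // => x xs; apply: IH => //; apply: hs.
by elim: t => A B IA IB /= /and4P[sA sB hA hB]; rewrite !aux.
Qed.

(** The two predicates are mutually recursive, so both equalities go through one induction. *)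
Lemma tree_series_parallel_dual (t : tree) :
  tree_series (tree_dual t) = tree_parallel t /\
  tree_parallel (tree_dual t) = tree_series t.
Proof.
elim: t => A B IA IB /=.
rewrite !nilp_sort !nilp_map !size_sort !size_map !all_sort !all_map.
split; congr (_ && (_ || _ && _)); apply: eq_in_all => x xs /=.
  by have [] := IB x xs.
by have [] := IA x xs.
Qed.

Lemma tree_circuit_dual (t : tree) :
  tree_series (tree_dual t) || tree_parallel (tree_dual t) =
  tree_series t || tree_parallel t.
Proof. by have [-> ->] := tree_series_parallel_dual t; rewrite orbC. Qed.

Lemma tree_size_dual (t : tree) : tree_size (tree_dual t) = tree_size t.
Proof.
have aux (s : seq tree) : {in s, forall x, tree_size (tree_dual x) = tree_size x} ->
    sumn (map tree_size (sort tree_le (map tree_dual s))) = sumn (map tree_size s).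
  move=> IH; have /perm_sumn -> : perm_eq
      (map tree_size (sort tree_le (map tree_dual s)))
      (map tree_size (map tree_dual s)) by apply: perm_map; rewrite perm_sort.
  by rewrite -map_comp; congr sumn; apply/eq_in_map.
elim: t => A B IA IB /=.
by rewrite !nilp_sort !nilp_map !aux // andbC addnC.
Qed.

Lemma foldr_add_sum (T : Type) (f : T -> rat) (s : seq T) :
  foldr (fun a x => f a + x) 0 s = \sum_(a <- s) f a.
Proof. by elim: s => [|a s IH]; rewrite ?big_nil // big_cons /= IH. Qed.

Lemma tree_resistance_Node (A B : seq tree) :
  tree_resistance (Node A B) =
  if nilp B then if nilp A then 1 else \sum_(a <- A) tree_resistance a
  else (\sum_(b <- B) (tree_resistance b)^-1)^-1.
Proof.
by rewrite /= (foldr_add_sum _ tree_resistance)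
  (foldr_add_sum _ (fun b => (tree_resistance b)^-1)).
Qed.

(** Sums are only formed over nonempty lists, so positivity passes through sums and inverses. *)
Lemma tree_resistance_gt0 (t : tree) : 0 < tree_resistance t.
Proof.
have aux (f : tree -> rat) (s : seq tree) : {in s, forall x, 0 < f x} ->
    ~~ nilp s -> 0 < \sum_(x <- s) f x.
  case: s => // x s hs _; rewrite big_cons ltr_pwDl ?hs ?mem_head //.
  by rewrite big_seq sumr_ge0 // => y ys; rewrite ltW // hs // inE ys orbT.
elim: t => A B IA IB; rewrite tree_resistance_Node.
case: ifPn => nB; last by rewrite invr_gt0 aux // => x xB; rewrite invr_gt0 IB.
by case: ifPn => // nA; apply: aux.
Qed.

(** In the dual of a series circuit, the inverse resistances of the dual parts are the original
    resistances, so the same sum appears inverted; the parallel case is symmetric. The hypothesis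
    excludes trees with two nonempty components, where the resistance is a junk value. *)
Lemma tree_resistance_dual (t : tree) : tree_series t || tree_parallel t ->
  tree_resistance (tree_dual t) = (tree_resistance t)^-1.
Proof.
have aux (f g : tree -> rat) (s : seq tree) :
    {in s, forall x, f (tree_dual x) = g x} ->
    \sum_(y <- sort tree_le (map tree_dual s)) f y = \sum_(x <- s) g x.
  move=> fg; rewrite (perm_big _ (permEl (perm_sort _ _))) big_map.
  by rewrite big_seq [RHS]big_seq; apply: eq_bigr.
elim: t => A B IA IB h.
rewrite [tree_dual _]/= !tree_resistance_Node !nilp_sort !nilp_map.
move: h => /= /orP[] /andP[-> /=].
- case: (nilp A) => [|/= /andP[_ /allP pA]]; first by rewrite invr1.
  by congr (_^-1); apply: aux => x xA; rewrite IA ?invrK // pA ?orbT.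
- case: (nilp B) => [|/= /andP[_ /allP pB]]; first by rewrite invr1.
  by rewrite invrK; apply: aux => x xB; rewrite IB // pB.
Qed.

Definition mtree_dual (t : mtree) : mtree :=
  exist (fun t => tree_sorted t) (tree_dual (val t)) (tree_dual_sorted (val t)).

Lemma mtree_dual_circuit (c : circuit) :
  is_series (mtree_dual (val c)) || is_parallel (mtree_dual (val c)).
Proof. by rewrite /is_series /is_parallel tree_circuit_dual (valP c). Qed.

Definition circuit_dual (c : circuit) : circuit :=
  exist (fun t => is_series t || is_parallel t) _ (mtree_dual_circuit c).

Lemma circuit_dualK : involutive circuit_dual.
Proof.
by move=> c; do 2![apply: val_inj] => /=; apply: tree_dualK; apply: (valP (val c)).
Qed.

Lemma circuit_size_dual (c : circuit) :
  circuit_size (circuit_dual c) = circuit_size c.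
Proof. exact: tree_size_dual. Qed.

Lemma resistance_dual (c : circuit) :
  resistance (circuit_dual c) = (resistance c)^-1.
Proof. exact: tree_resistance_dual (valP c). Qed.

Lemma resistance_gt0 (c : circuit) : 0 < resistance c.
Proof. exact: tree_resistance_gt0. Qed.

Lemma ncircuit_dual_subproof (n : nat) (c : ncircuit n) :
  circuit_size (circuit_dual (val c)) == n.
Proof. by rewrite circuit_size_dual (valP c). Qed.

Definition ncircuit_dual (n : nat) (c : ncircuit n) : ncircuit n :=
  exist (fun c => circuit_size c == n) _ (ncircuit_dual_subproof n c).

Lemma ncircuit_dualK (n : nat) : involutive (@ncircuit_dual n).
Proof. by move=> c; apply: val_inj; apply: circuit_dualK. Qed.

Lemma total_resistance_inv (n : nat) :
  total_resistance n = \sum_(c : ncircuit n) (resistance (val c))^-1.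
Proof.
rewrite /total_resistance (reindex_inj (inv_inj (ncircuit_dualK n))).
by apply: eq_bigr => c _; apply: resistance_dual.
Qed.

Lemma ler2_addV (F : numFieldType) (x : F) : 0 < x -> 2 <= x + x^-1.
Proof.
move=> x0; rewrite -subr_ge0.
have -> : x + x^-1 - 2 = (x - 1) ^+ 2 / x.
  rewrite sqrrB1 !mulrDl expr2 mulfK ?gt_eqF // mulNr mulrnAl mulfV ?gt_eqF //.
  by rewrite mul1r addrAC.
(* The order may be partial, so the square is nonnegative because [x - 1] is real, which follows
   from the positivity of [x]. *)
by rewrite divr_ge0 ?(ltW x0) // real_exprn_even_ge0 // rpredB ?gtr0_real.
Qed.

(** This makes the division in the mean a genuine one, since dividing by zero would give zero. *)
Lemma circuit_count_gt0 (n : nat) : (0 < n)%N -> (0 < circuit_count n)%N.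
Proof.
(* The witness is [n] units in series. A series of one part is not a circuit, so for [n = 1] the
   empty list is taken, which gives the unit circuit. *)
move=> n0; pose k := if n == 1%N then 0%N else n.
pose t := Node (nseq k (Node [::] [::])) [::].
have st : tree_sorted t.
  by rewrite /= all_nseq orbT !andbT sorted_nseq // => x; apply: leqnn.
have ct : is_series (exist (fun t => tree_sorted t) t st)
       || is_parallel (exist (fun t => tree_sorted t) t st).
  apply/orP; left; rewrite /is_series /= /nilp size_nseq all_nseq orbT andbT /k.
  by case: ifP => //; case: (n) n0 => [|[]].
pose c : circuit := exist (fun t => is_series t || is_parallel t) _ ct.
have sc : circuit_size c == n.
  rewrite /circuit_size /= /nilp size_nseq andbT addn0 map_nseq sumn_nseq mul1n /k.
  by case: (eqVneq n 1%N) => [-> //|_]; rewrite (gtn_eqF n0).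
by apply/card_gt0P; exists (exist (fun c => circuit_size c == n) c sc).
Qed.

Theorem corollary2p1p1 (n : nat) (hn : (0 < n)%N) : 1 <= mean_resistance n.
Proof.
rewrite /mean_resistance ler_pdivlMr ?ltr0n ?circuit_count_gt0 // mul1r.
rewrite -(ler_pMn2r (isT : (0 < 2)%N)) [leRHS]mulr2n {2}total_resistance_inv.
(* Twice the count becomes a sum of the constant 2 over the circuits, ready for a termwise
   comparison. *)
rewrite -big_split /= -mulrnA mulnC mulrnA /circuit_count -sumr_const.
by apply: ler_sum => c _; apply: ler2_addV; apply: resistance_gt0.
Qed.
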